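(* Let $X$ be a Banach space. If $1\leq q < s < \infty$, then $$\ell_{m(s;q)}(X)= \ell^{A}_{(s,q,s)}(X)$$ and $$\left\| (x_j)_{j=1}^\infty \right\|_{m(s;q)} = \left\| (x_j)_{j=1}^\infty \right\|_{A(s,q,s)}$$ for every $(x_j)_{j=1}^\infty$ in this space.
   Context: Banach spaces are over $\mathbb{K}=\mathbb{R}$ or $\mathbb{C}$; $B_X$ is the closed unit ball of $X$ and $X^*$ its topological dual. $\ell_p(X)$ (with $\ell_p=\ell_p(\mathbb{K})$) is the space of absolutely $p$-summable $X$-valued sequences with its usual norm $\|\cdot\|_p$. $\ell_p^w(X)$ is the space of weakly $p$-summable $X$-valued sequences with norm $\|(x_j)_j\|_{w,p}=\sup_{x^*\in B_{X^*}}\|(x^*(x_j))_{j=1}^\infty\|_p$. Mixed summable sequences: define $s(q)'$ by $\frac1{s(q)'}+\frac1s=\frac1q$. The space $\ell_{m(s;q)}(X)$ of mixed $(s;q)$-summable sequences consists of all sequences $(x_j)_{j=1}^\infty$ in $X$ that can be written as $x_j=\tau_jy_j$ for all $j\in\mathbb{N}$ with $(\tau_j)_{j=1}^\infty\in\ell_{s(q)'}$ and $(y_j)_{j=1}^\infty\in\ell_s^w(X)$; its norm is $\|(x_j)_{j=1}^\infty\|_{m(s;q)}=\inf\|(\tau_j)_{j=1}^\infty\|_{s(q)'}\|(y_j)_{j=1}^\infty\|_{w,s}$, the infimum being over all such representations. Anisotropic summable sequences: for $1\le s,q,r<\infty$ with $q<s$ and $r\le s$, the space $\ell^{A}_{(s,q,r)}(X)$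 consists of all sequences $(x_j)_{j=1}^\infty$ in $X$ such that $\sum_{j=1}^\infty\left(\sum_{k=1}^\infty|x_k^*(x_j)|^s\right)^{q/s}<\infty$ for every $(x_k^* )_{k=1}^\infty\in\ell_r(X^* )$, with the norm $$\|(x_j)_{j=1}^\infty\|_{A(s,q,r)}=\sup_{(x_k^* )_k\in B_{\ell_r(X^* )}}\left(\sum_{j=1}^\infty\left(\sum_{k=1}^\infty|x_k^*(x_j)|^s\right)^{q/s}\right)^{1/q}.$$ Here it is used with $r=s$. *)

(* Defs.v *)
From HB Require Import structures.
From mathcomp Require Import all_boot all_order all_algebra.
From mathcomp Require Import complex.
From mathcomp Require Import all_classical all_reals all_analysis.

Set Implicit Arguments.
Unset Strict Implicit.
Unset Printing Implicit Defensive.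
Import Order.TTheory GRing.Theory Num.Theory.
Import numFieldNormedType.Exports.
Local Open Scope classical_set_scope.
Local Open Scope ring_scope.

(* [K] is the field of real or of complex numbers.  In MathComp-Analysis the
   norm of a normed module over [K] takes its values in [K], so [re] is the map
   which turns these values into elements of [R]. *)
Variant real_or_complex (R : realType) : forall K : numFieldType, (K -> R) -> Prop :=
| IsReal : @real_or_complex R R (fun a : R => a)
| IsComplex : @real_or_complex R R[i] (@complex.Re R).

Section scalars.
Context {R : realType} {K : numFieldType} (re : K -> R).

Definition rnorm (V : normedZmodType K) (v : V) : R := re `|v|.

(* Integration against the counting measure of [nat] is summation, so this is
   [(\sum_j `|a j| `^ p) `^ p^-1]; all norms below are extended-real valued. *)
Definition lp_enorm (p : R) (a : nat -> \bar R) : \bar R :=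
  'N[counting]_(p%:E)[a].

Definition lp_norm (V : normedZmodType K) (p : R) (x : nat -> V) : \bar R :=
  lp_enorm p (fun j => (rnorm (x j))%:E).

Definition lp (V : normedZmodType K) (p : R) : set (nat -> V) :=
  [set x | (lp_norm p x < +oo)%E].

Section spaces.
Variable X : normedModType K.

Record dual := Dual {
  dual_fun :> {linear X -> K^o};
  dual_continuous : continuous dual_fun }.

Definition dual_norm (f : dual) : \bar R :=
  ereal_sup [set (rnorm (f x))%:E | x in [set x : X | `|x| <= 1]].

Definition dual_lp_norm (r : R) (f : nat -> dual) : \bar R :=
  lp_enorm r (fun k => dual_norm (f k)).

Definition weak_lp (p : R) : set (nat -> X) :=
  [set x | forall f : dual, lp p (fun j => f (x j))].

Definition weak_lp_norm (p : R) (x : nat -> X) : \bar R :=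
  ereal_sup [set lp_norm p (fun j => f (x j)) | f in
              [set f : dual | (dual_norm f <= 1)%E]].

(* The exponent s(q)' : 1 / s(q)' + 1 / s = 1 / q. *)
Definition mixed_exponent (s q : R) : R := (q^-1 - s^-1)^-1.

Definition mixed_representation (s q : R) (x : nat -> X) :
    set ((nat -> K) * (nat -> X)) :=
  [set ty | [/\ lp (mixed_exponent s q) ty.1, weak_lp s ty.2 &
                forall j, x j = ty.1 j *: ty.2 j]].

Definition mixed (s q : R) : set (nat -> X) :=
  [set x | mixed_representation s q x !=set0].

Definition mixed_norm (s q : R) (x : nat -> X) : \bar R :=
  ereal_inf [set (lp_norm (mixed_exponent s q) ty.1 * weak_lp_norm s ty.2)%E
            | ty in mixed_representation s q x].

Definition anisotropic_sum (s q : R) (f : nat -> dual) (x : nat -> X) : \bar R :=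
  (\sum_(0 <= j <oo)
    (\sum_(0 <= k <oo) (rnorm (f k (x j)) `^ s)%:E) `^ (q / s))%E.

Definition anisotropic (s q r : R) : set (nat -> X) :=
  [set x | forall f : nat -> dual,
    (dual_lp_norm r f < +oo -> anisotropic_sum s q f x < +oo)%E].

Definition anisotropic_norm (s q r : R) (x : nat -> X) : \bar R :=
  ereal_sup [set (anisotropic_sum s q f x `^ q^-1)%E | f in
              [set f : nat -> dual | (dual_lp_norm r f <= 1)%E]].

End spaces.
End scalars.

Arguments mixed {R K} re X s q.
Arguments anisotropic {R K} re X s q r.

(* Main.v *)
(* Put th = q / s and p = s(q)'. If x_j = tau_j y_j, exchanging sums gives
   \sum_j \sum_k |f_k(y_j)|^s <= ||f||_s^s ||y||_{w,s}^s, and Hoelder's inequality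
   with the exponents p / q and s / q bounds the anisotropic norm by the mixed
   norm; that ||y||_{w,s} is finite is the uniform boundedness principle.

   Conversely, the sequences A_j = \sum_k |f_k(x_j)|^s, for (f_k) in the unit ball
   of l_s(X^* ), form a convex set on which \sum_j A_j^th is at most the q-th power
   of the anisotropic norm. At a maximizer c of this concave functional the
   first-order condition reads \sum_j |g(x_j)|^s c_j^(th - 1) <= \sum_j c_j^th for
   every g in the dual unit ball. As s / p = 1 / th - 1, this says exactly that
   tau_j = c_j^(th / p), y_j = x_j / tau_j is an optimal representation of x. Since
   a maximizer need not exist, c is a limit of near-maximizers of a slightly
   perturbed functional and the representation is only optimal up to epsilon. *)
From HB Require Import structures.
Require Import Defs.
From mathcomp Require Import all_boot all_order all_algebra.
From mathcomp Require Import all_classical all_reals all_analysis.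
From mathcomp Require Import complex ring lra.

Set Implicit Arguments.
Unset Strict Implicit.
Unset Printing Implicit Defensive.
Import Order.TTheory GRing.Theory Num.Theory.
Import numFieldNormedType.Exports.
Local Open Scope classical_set_scope.
Local Open Scope ring_scope.

(** * Series and real powers *)

Lemma nneseries_leP (R : realType) (u : nat -> R) (M : R) :
  (forall k, 0 <= u k) ->
  (\sum_(0 <= k <oo) (u k)%:E <= M%:E)%E <-> forall N, \sum_(k < N) u k <= M.
Proof.
move=> u0; split=> [uM N|uM].
  rewrite -lee_fin -sumEFin; apply: le_trans uM.
  rewrite -(big_mkord xpredT (fun k => (u k)%:E)).
  by apply: nneseries_lim_ge => k _; rewrite lee_fin.
apply: lime_le; first by apply: is_cvg_nneseries => k _ _; rewrite lee_fin.
by apply: nearW => N; rewrite big_mkord sumEFin lee_fin.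
Qed.

(** Young's inequality with exponents 1/th and 1/(1 - th), applied to (a/c)^th and 1 and multiplied
    by c^th: the graph of a concave power lies below its tangents. *)
Lemma powR_tangent (R : realType) (th a c : R) :
  0 < th -> th < 1 -> 0 <= a -> 0 < c ->
  a `^ th <= c `^ th + th * c `^ (th - 1) * (a - c).
Proof.
move=> th0 th1 a0 c0.
have u0 : 0 <= a / c by rewrite divr_ge0// ltW.
have th10 : 0 < (1 - th)^-1 by rewrite invr_gt0 subr_gt0.
have thV : th^-1^-1 + (1 - th)^-1^-1 = 1 by rewrite !invrK subrKC.
have thi0 : 0 < th^-1 by rewrite invr_gt0.
have := conjugate_powR (powR_ge0 (a / c) th) ler01 thi0 th10 thV.
rewrite -powRrM mulfV ?gt_eqF// powRr1// powR1 mulr1 !invrK mul1r => H.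
have -> : a `^ th = c `^ th * (a / c) `^ th.
  by rewrite -powRM// ?ltW// mulrC divfK// gt_eqF.
have -> : c `^ th = c * c `^ (th - 1) by rewrite mulr_powRB1// ltW.
set w := c `^ (th - 1).
have -> : c * w + th * w * (a - c) = c * w * (a / c * th + (1 - th)).
  by field; rewrite gt_eqF.
by rewrite ler_wpM2l// mulr_ge0// ?powR_ge0 ?ltW.
Qed.

Lemma powR_continuous_gt0 (R : realType) (r x : R) : 0 < x ->
  {for x, continuous (fun y => y `^ r)}.
Proof.
move=> x0; apply: differentiable_continuous; apply/derivable1_diffP.
by apply: derivable_powR; rewrite in_itv/= x0.
Qed.

(** * The first-order condition at a maximizer *)

Lemma fmap_ultra (T T' : Type) (f : T -> T') (F : set_system T) :
  UltraFilter F -> UltraFilter (f @ F).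
Proof.
move=> UF; split; first exact: fmap_proper_filter.
move=> G PG FG; apply/seteqP; split => // A GA.
have [//|FnA] := in_ultra_setVsetC (f @^-1` A) UF.
have : G (A `&` ~` A) by apply: filterI => //; exact: FG.
by rewrite setICr => /(@filter_not_empty _ G).
Qed.

(* [c] is a limit of near-maximizers over [S] of the concave functional
   [A |-> \sum_j (A j + d j) `^ th]; the last conclusion is the first-order
   condition at [c] in the direction of [b]. The shift [d] keeps [c] away from
   [0], where the derivative blows up. *)
Lemma concave_sum_maximizer (R : realType) (th M : R) (S T : set (nat -> R))
    (B d : nat -> R) :
  0 < th -> th < 1 -> S !=set0 ->
  (forall A, S A -> forall j, 0 <= A j <= B j) ->
  (forall b, T b -> forall j, 0 <= b j) ->
  (forall A b t, S A -> T b -> 0 <= t <= 1 ->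
    S (fun j => (1 - t) * A j + t * b j)) ->
  (forall j, 0 < d j) ->
  (forall A N, S A -> \sum_(j < N) (A j + d j) `^ th <= M) ->
  exists c : nat -> R, [/\ forall j, 0 < c j,
    forall N, \sum_(j < N) c j `^ th <= M &
    forall b N, T b -> \sum_(j < N) b j * c j `^ (th - 1) <= M].
Proof.
move=> th0 th1 [A0 SA0] SB T0 Sconv d0 SM.
(* Collecting all finite partial sums makes [sup E] the supremum of the functional without forming
   any infinite series. *)
pose E := [set z : R | exists A N, S A /\ z = \sum_(j < N) (A j + d j) `^ th].
have E0 : E !=set0 by exists 0, A0, 0%N; rewrite big_ord0.
have EM : ubound E M by move=> _ [A [N [SA ->]]]; exact: SM.
have supE : has_sup E by split => //; exists M.
have leM' A N : S A -> \sum_(j < N) (A j + d j) `^ th <= sup E.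
  by move=> SA; apply: ub_le_sup; [exists M | exists A, N].
have M'M : sup E <= M by exact: ge_sup.
(* A step that tends to 0 and stays below 1. The defect allowed for [A n] is its square, so it
   vanishes even after division by the step. *)
pose t n : R := 2^-1 * n.+1%:R^-1.
have t0 n : 0 < t n by rewrite mulr_gt0 ?invr_gt0.
have t1 n : t n < 1.
  rewrite (@le_lt_trans _ _ 2^-1)//; last by lra.
  by rewrite ler_piMr// ?invr_ge0// invf_le1// ler1n.
have /choice[A HA] n : exists A : nat -> R, S A /\
    exists N, sup E - t n ^+ 2 < \sum_(j < N) (A j + d j) `^ th.
  have [|_ [A [N [SA ->]]] H] := @sup_adherent _ E (t n ^+ 2) _ supE.
    by rewrite exprn_gt0.
  by exists A; split => //; exists N.
have SA n : S (A n) by case: (HA n).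
pose c n (b : nat -> R) j := (1 - t n) * A n j + t n * b j + d j.
have c0 n b j : T b -> 0 < c n b j.
  move=> Tb; rewrite ltr_wpDl// addr_ge0// mulr_ge0//.
  - by rewrite subr_ge0 ltW.
  - by case/andP: (SB _ (SA n) j).
  - exact/ltW.
  - exact: T0.
(* The first-order condition at stage [n]. The factor 1/(1 - t_n) comes from (1 - t_n) A_n <= c_n,
   and t_n/th is the defect t_n^2 divided by th t_n. *)
have key n b N : T b ->
    \sum_(j < N) b j * c n b j `^ (th - 1) <= sup E / (1 - t n) + t n / th.
  move=> Tb; have [_ [N0 HN0]] := HA n.
  pose w j := c n b j `^ (th - 1).
  have w0 j : 0 <= w j by exact: powR_ge0.
  have A0' j : 0 <= A n j by case/andP: (SB _ (SA n) j).
  (* Long enough for both the requested sum and the one at which [A n] is nearly maximal; adding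
     nonnegative terms only increases either. *)
  pose m := maxn N N0.
  have mono N1 (u : nat -> R) : (forall j, 0 <= u j) -> (N1 <= m)%N ->
      \sum_(j < N1) u j <= \sum_(j < m) u j.
    move=> u0 N1m; rewrite (big_ord_widen_cond m xpredT u)//=.
    rewrite [leRHS](bigID (fun j : 'I_m => (j < N1)%N))/= lerDl.
    by apply: sumr_ge0.
  have Sc : S (fun j => (1 - t n) * A n j + t n * b j).
    by apply: Sconv => //; rewrite !ltW.
  have cM : \sum_(j < m) c n b j `^ th <= sup E by exact: (leM' _ m Sc).
  have Aw : \sum_(j < m) A n j * w j <= sup E / (1 - t n).
    rewrite ler_pdivlMr ?subr_gt0// mulr_suml (le_trans _ cM)//.
    apply: ler_sum => j _.
    rewrite -(mulr_powRB1 (ltW (c0 n b j Tb)) th0) mulrAC -/(w j) ler_wpM2r//.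
    rewrite mulrC /c -addrA lerDl.
    exact: addr_ge0 (mulr_ge0 (ltW (t0 n)) (T0 b Tb j)) (ltW (d0 j)).
  (* Moving from [A n] by a step [t n] towards [b] gains at most [t n ^+ 2], the
     defect of [A n]; the tangent at the endpoint [c n b] bounds the gain from
     below. *)
  have lb : sup E - t n ^+ 2 <= sup E +
      th * t n * (\sum_(j < m) A n j * w j - \sum_(j < m) b j * w j).
    apply: (le_trans (ltW HN0)).
    apply: (le_trans (mono N0 (fun j => (A n j + d j) `^ th) _ (leq_maxr _ _))).
      by move=> j; exact: powR_ge0.
    rewrite -sumrB mulr_sumr -lerBlDr (le_trans _ cM)// -sumrB.
    apply: ler_sum => j _; rewrite lerBlDr.
    have Ad0 : 0 <= A n j + d j by rewrite addr_ge0// ltW.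
    apply: le_trans (powR_tangent th0 th1 Ad0 (c0 n b j Tb)) _.
    by rewrite lerD2l -/(w j) /c le_eqVlt; apply/orP; left; apply/eqP; ring.
  apply: (le_trans (mono N (fun j => b j * w j) _ (leq_maxl _ _))).
    by move=> j; rewrite mulr_ge0// T0.
  apply: (@le_trans _ _ (\sum_(j < m) A n j * w j + t n / th)); last first.
    by rewrite lerD2r.
  rewrite -lerBlDl ler_pdivlMr//.
  have tn0 := t0 n; rewrite -(ler_pM2r tn0); lra.
(* Along one ultrafilter every coordinate converges, since [A n j] stays in the compact segment from
   0 to [B j]; this replaces a diagonal subsequence. *)
have [U [UU oU]] := ultraFilterLemma (eventually_filter).
have tU : t n @[n --> U] --> (0 : R).
  apply: cvg_trans; first by apply: cvg_app oU.
  rewrite -[X in _ --> X](mulr0 (2^-1)).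
  by apply: cvgM; [exact: cvg_cst | exact: cvg_harmonic].
have /choice[p pU] : forall j, exists p : R, A n j @[n --> U] --> p.
  move=> j.
  have := @segment_compact R 0 (B j); rewrite compact_ultra => /(_ ((A ^~ j) @ U)).
  case; [exact: fmap_ultra | | by move=> p [_ Hp]; exists p].
  by apply: (@filterE _ U) => n /=; rewrite in_itv/=; exact: SB.
(* As the step tends to 0, the limit does not depend on [b]: one point serves all directions. *)
have cU b j : c n b j @[n --> U] --> p j + d j.
  have -> : p j + d j = (1 - 0) * p j + 0 * b j + d j by ring.
  apply: cvgD; last exact: cvg_cst.
  apply: cvgD; apply: cvgM; [|exact: pU|exact: tU|exact: cvg_cst].
  by apply: cvgB; [exact: cvg_cst|exact: tU].
have p0 j : 0 <= p j.
  apply: (cvgr_to_ge (pU j)); apply: filterE => n.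
  by case/andP: (SB _ (SA n) j).
have pd0 j : 0 < p j + d j by rewrite ltr_wpDl.
exists (fun j => p j + d j); split => //.
- move=> N; have H : (\sum_(j < N) (A n j + d j) `^ th) @[n --> U] -->
      \sum_(j < N) (p j + d j) `^ th.
    apply: cvg_big => [|j _]; first exact: add_continuous.
    apply: (continuous_cvg _ (powR_continuous_gt0 (r := th) (pd0 j))).
    by apply: cvgD; [exact: pU | exact: cvg_cst].
  by apply: (cvgr_to_le H); apply: filterE => n; exact: SM.
- move=> b N Tb; apply: le_trans M'M.
  have H : (\sum_(j < N) b j * c n b j `^ (th - 1)) @[n --> U] -->
      \sum_(j < N) b j * (p j + d j) `^ (th - 1).
    apply: cvg_big => [|j _]; first exact: add_continuous.
    apply: cvgM; first exact: cvg_cst.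
    exact: (continuous_cvg _ (powR_continuous_gt0 (r := th - 1) (pd0 j))).
  have K : (sup E / (1 - t n) + t n / th) @[n --> U] --> sup E / (1 - 0) + 0 / th.
    apply: cvgD; last by apply: cvgM; [exact: tU|exact: cvg_cst].
    apply: cvgM; first exact: cvg_cst.
    apply: cvgV; first by rewrite subr0.
    by apply: cvgB; [exact: cvg_cst|exact: tU].
  rewrite subr0 divr1 mul0r addr0 in K.
  by apply: (ler_cvg_to H K); apply: filterE => n; exact: key.
Qed.

(** * The scalar field *)

Section scalar_field.
Context {R : realType} {K : numFieldType} (re : K -> R).
Hypothesis hK : real_or_complex re.

(** Collects what the real and the complex case share, so that most facts on [rnorm] below need no
    case distinction. *)
Lemma scalar_embedding : exists iota : {rmorphism R -> K},
  [/\ cancel iota re, forall z, 0 <= z -> iota (re z) = z,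
      {mono iota : a b / a <= b} & {morph re : z w / z + w}].
Proof.
case: hK; [exists idfun | exists (real_complex R)]; split => //=.
- by move=> z z0; rewrite RRe_real// ger0_real.
- by move=> a b; rewrite lecR.
- by move=> [a b] [c d].
Qed.

Lemma re_ge0 z : 0 <= z -> 0 <= re z.
Proof.
case: hK z => // -[a b]; by rewrite lecE /= => /andP[].
Qed.

(** The rate [e] passes to the limit by continuity of the modulus; in the complex case it also
    controls real and imaginary parts. This produces the pointwise limit of functionals in the
    gliding hump argument. *)
Lemma scalar_complete (u : nat -> K) (e : nat -> R) :
  e @ \oo --> 0 ->
  (forall n m, (n <= m)%N -> rnorm re (u m - u n) <= e n) ->
  exists l : K, forall n, rnorm re (l - u n) <= e n.
Proof.
have real_complete (v : nat -> R) : e @ \oo --> 0 ->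
  (forall n m, (n <= m)%N -> `|v m - v n| <= e n) -> exists l : R, v @ \oo --> l.
  move=> e0 ve; suff : cvg (v @ \oo) by rewrite cvg_ex.
  apply: cauchy_cvg; apply: cauchy_exP => d d0.
  have [N _ Nd] : \forall n \near \oo, e n < d by apply: (cvgr_lt 0).
  exists (v N), N => // n /= Nn; rewrite -ball_normE /= distrC.
  by apply: le_lt_trans (ve _ _ Nn) (Nd _ _) => /=.
rewrite /rnorm; case: hK u => u e0 ue.
  have [l ul] := real_complete u e0 ue; exists l => n.
  have H : `|u m - u n| @[m --> \oo] --> `|l - u n|.
    by apply: cvg_norm; apply: cvgB => //; exact: cvg_cst.
  by apply: (cvgr_to_le H); exists n => // m; exact: ue.
have ReB (z w : R[i]) : complex.Re (z - w) = complex.Re z - complex.Re w.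
  by case: z w => ? ? [].
have ImB (z w : R[i]) : complex.Im (z - w) = complex.Im z - complex.Im w.
  by case: z w => ? ? [].
have normcE (z : R[i]) :
    complex.Re `|z| = Num.sqrt (complex.Re z ^+ 2 + complex.Im z ^+ 2).
  by rewrite normc_def.
have Re_cauchy n m : (n <= m)%N -> `|complex.Re (u m) - complex.Re (u n)| <= e n.
  move=> nm; apply: le_trans (ue _ _ nm); rewrite normcE -sqrtr_sqr ler_wsqrtr//.
  by rewrite ReB ImB lerDl sqr_ge0.
have Im_cauchy n m : (n <= m)%N -> `|complex.Im (u m) - complex.Im (u n)| <= e n.
  move=> nm; apply: le_trans (ue _ _ nm); rewrite normcE -sqrtr_sqr ler_wsqrtr//.
  by rewrite ReB ImB lerDr sqr_ge0.
have [a ua] := real_complete _ e0 Re_cauchy.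
have [b ub] := real_complete _ e0 Im_cauchy.
exists (Complex a b) => n; rewrite normcE ReB ImB.
have H : Num.sqrt ((complex.Re (u m) - complex.Re (u n)) ^+ 2 +
      (complex.Im (u m) - complex.Im (u n)) ^+ 2) @[m --> \oo] -->
    Num.sqrt ((a - complex.Re (u n)) ^+ 2 + (b - complex.Im (u n)) ^+ 2).
  apply: continuous_cvg; first exact: sqrt_continuous.
  by apply: cvgD; rewrite expr2; (under eq_cvg do rewrite expr2);
    apply: cvgM; apply: cvgB => //; exact: cvg_cst.
apply: (cvgr_to_le H); exists n => // m /= nm.
by have := ue _ _ nm; rewrite normcE ReB ImB.
Qed.


Lemma rnorm_ge0 (V : normedZmodType K) (v : V) : 0 <= rnorm re v.
Proof. by rewrite /rnorm re_ge0. Qed.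

Lemma le_re z w : 0 <= z -> z <= w -> re z <= re w.
Proof.
have [iota [_ _ _ reD]] := scalar_embedding.
by move=> z0 zw; rewrite -[w](subrK z) reD lerDr re_ge0// subr_ge0.
Qed.

Lemma rnormD (V : normedZmodType K) (v w : V) :
  rnorm re (v + w) <= rnorm re v + rnorm re w.
Proof.
have [iota [_ _ _ reD]] := scalar_embedding.
by rewrite /rnorm -reD le_re// ler_normD.
Qed.

Lemma rnormN (V : normedZmodType K) (v : V) : rnorm re (- v) = rnorm re v.
Proof. by rewrite /rnorm normrN. Qed.

Lemma rnorm0 (V : normedZmodType K) : rnorm re (0 : V) = 0.
Proof.
have [iota [iK _ _ _]] := scalar_embedding.
by rewrite /rnorm normr0 -(rmorph0 iota) iK.
Qed.

Lemma rnorm_gt0 (V : normedZmodType K) (v : V) : (0 < rnorm re v) = (v != 0).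
Proof.
have [iota [iK reK _ _]] := scalar_embedding.
apply/idP/idP => [|v0]; first by apply: contraTneq => ->; rewrite rnorm0 ltxx.
rewrite lt_def rnorm_ge0 andbT; apply: contra v0 => /eqP v0.
by rewrite -normr_eq0 -(reK `|v|)// -/(rnorm re v) v0 rmorph0.
Qed.

Lemma rnormM (a b : K) : rnorm re (a * b) = rnorm re a * rnorm re b.
Proof.
have [iota [iK reK _ _]] := scalar_embedding.
by rewrite /rnorm normrM -{1}(reK `|a|)// -{1}(reK `|b|)// -rmorphM iK.
Qed.

Lemma rnormZ (V : normedModType K) (a : K) (v : V) :
  rnorm re (a *: v) = rnorm re a * rnorm re v.
Proof.
have [iota [iK reK _ _]] := scalar_embedding.
by rewrite /rnorm normrZ -{1}(reK `|a|)// -{1}(reK `|v|)// -rmorphM iK.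
Qed.

Lemma rnorm_le1 (V : normedZmodType K) (v : V) : (`|v| <= 1) = (rnorm re v <= 1).
Proof.
have [iota [iK reK iota_le _]] := scalar_embedding.
by rewrite -(reK `|v|)// -(rmorph1 iota) iota_le.
Qed.

Lemma rnorm1 : rnorm re (1 : K) = 1.
Proof.
have [iota [iK _ _ _]] := scalar_embedding.
by rewrite /rnorm normr1 -(rmorph1 iota) iK.
Qed.

Lemma exists_rnorm (t : R) : 0 <= t -> exists a : K, rnorm re a = t.
Proof.
have [iota [iK _ iota_le _]] := scalar_embedding.
move=> t0; exists (iota t).
by rewrite /rnorm ger0_norm ?iK// -(rmorph0 iota) iota_le.
Qed.

End scalar_field.

(** * Bounded functionals *)

Section functionals.
Context {R : realType} {K : numFieldType} (re : K -> R).
Hypothesis hK : real_or_complex re.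
Variable X : normedModType K.

(** Stated for plain functions, so that limits and multiples of functionals can be estimated before
    their continuity is known. *)
Definition functional_bound (f : X -> K^o) (D : R) :=
  forall x, rnorm re (f x) <= D * rnorm re x.

(** A nonzero [x] is moved to the unit sphere by a scalar of absolute value 1/||x||. *)
Lemma dual_normP (f : dual X) (D : R) : 0 <= D ->
  (dual_norm re f <= D%:E)%E <-> functional_bound f D.
Proof.
move=> D0; split=> [fD x|fD]; last first.
  apply: ge_ereal_sup => _ [x /= + <-]; rewrite (rnorm_le1 hK) => x1.
  by rewrite lee_fin (le_trans (fD x))// ler_piMr.
have [x0|x0] := eqVneq x 0; first by rewrite x0 linear0 !(rnorm0 hK) mulr0.
have nx0 : 0 < rnorm re x by rewrite (rnorm_gt0 hK).
have nV0 : 0 <= (rnorm re x)^-1 by rewrite invr_ge0 ltW.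
have [a ra] := exists_rnorm hK nV0.
have : ((rnorm re (f (a *: x)))%:E <= D%:E)%E.
  apply: le_trans fD; apply: ereal_sup_ubound; exists (a *: x) => //=.
  by rewrite (rnorm_le1 hK) (rnormZ hK) ra mulVf// gt_eqF.
by rewrite lee_fin linearZ (rnormZ hK) ra ler_pdivrMl// [rnorm re x * _]mulrC.
Qed.

Lemma dual_bounded (f : dual X) : exists2 D, 0 <= D & functional_bound f D.
Proof.
have [iota [iK reK _ _]] := scalar_embedding hK.
have /linear_bounded_continuous/linear_boundedP/pinfty_ex_gt0[r r0 fr] :=
  @dual_continuous _ _ f.
exists (re r) => [|x]; first exact/(re_ge0 hK)/ltW.
have -> : re r * rnorm re x = re (r * `|x|).
  by rewrite /rnorm -{2}(reK r) ?ltW// -{2}(reK `|x|)// -rmorphM iK.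
by apply: (le_re hK).
Qed.

Lemma dual_of_bounded (f : X -> K^o) D : linear f -> functional_bound f D ->
  exists F : dual X, F =1 f.
Proof.
move=> lf fD; have [iota [iK reK iota_le _]] := scalar_embedding hK.
pose F : {linear X -> K^o} := HB.pack f (GRing.isLinear.Build _ _ _ _ _ lf).
have cF : continuous F.
  apply/linear_bounded_continuous/linear_boundedP; near=> r => x.
  apply: (@le_trans _ _ (iota D * `|x|)).
    by rewrite -(reK `|F x|)// -(reK `|x|)// -rmorphM iota_le; exact: fD.
  rewrite ler_wpM2r//; near: r; apply: nbhs_pinfty_ge.
  rewrite realE -(rmorph0 iota) !iota_le. exact: le_total.
by exists (Dual cF).
Unshelve. all: by end_near. Qed.

Lemma exists_dual0 : exists F : dual X, forall x, F x = 0.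
Proof.
apply: (@dual_of_bounded (fun=> 0) 0) => [a u v|x].
  by rewrite scaler0 addr0.
by rewrite (rnorm0 hK) mul0r.
Qed.

End functionals.

(** * Uniform boundedness of weakly summable sequences *)

(** The sum is at most twice the larger term. This crude constant stands in for Minkowski's
    inequality. *)
Lemma powRD_le (R : realType) (s a b : R) : 0 <= s -> 0 <= a -> 0 <= b ->
  (a + b) `^ s <= 2 `^ s * (a `^ s + b `^ s).
Proof.
move=> s0; wlog ab : a b / a <= b => [H a0 b0|a0 b0].
  have [ab|/ltW ba] := leP a b; first exact: H.
  by rewrite addrC [X in _ * X]addrC; exact: H.
apply: (@le_trans _ _ ((2 * b) `^ s)).
  by rewrite ge0_ler_powR// ?nnegrE ?addr_ge0 ?mulr_ge0//; lra.
by rewrite powRM// ler_wpM2l ?powR_ge0// lerDr powR_ge0.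
Qed.

Lemma powRV (R : realType) (a r : R) : 0 <= a -> a^-1 `^ r = (a `^ r)^-1.
Proof. by move=> a0; rewrite -(powR_inv1 a0) powRAC powR_inv1 ?powR_ge0. Qed.

(** For [D] positive, a scalar of absolute value 1/D brings [f] into the unit ball; for [D] zero,
    [f] vanishes and both sides are 0. *)
Lemma sum_rnorm_homogeneous (R : realType) (K : numFieldType) (re : K -> R)
    (hK : real_or_complex re) (X : normedModType K) (s : R) (y : nat -> X)
    (N : nat) (W : R) :
  0 < s ->
  (forall f : X -> K^o, linear f -> functional_bound re f 1 ->
    \sum_(j < N) rnorm re (f (y j)) `^ s <= W) ->
  forall (f : X -> K^o) D, linear f -> 0 <= D -> functional_bound re f D ->
    \sum_(j < N) rnorm re (f (y j)) `^ s <= D `^ s * W.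
Proof.
move=> s0 HW f D lf D0 fD; have [D00|Dn0] := eqVneq D 0.
  rewrite D00 powR0 ?mul0r ?gt_eqF// big1// => j _.
  have := fD (y j); rewrite D00 mul0r => fy.
  have -> : rnorm re (f (y j)) = 0 by apply/le_anti; rewrite fy (rnorm_ge0 hK).
  by rewrite powR0// gt_eqF.
have Dgt0 : 0 < D by rewrite lt_def Dn0.
have [|a ra] := exists_rnorm hK (t := D^-1); first by rewrite invr_ge0.
have : \sum_(j < N) rnorm re (a *: f (y j)) `^ s <= W.
  apply: (HW (fun x => a *: f x)) => [b u v|x].
    by rewrite lf scalerDr !scalerA mulrC.
  by rewrite (rnormZ hK) ra mul1r ler_pdivrMl.
under eq_bigr do rewrite (rnormZ hK) powRM ?(rnorm_ge0 hK)//.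
by rewrite -mulr_sumr ra powRV// ler_pdivrMl// powR_gt0.
Qed.

Section uniform_boundedness.
Context {R : realType} {K : numFieldType} (re : K -> R).
Hypothesis hK : real_or_complex re.
Variables (X : normedModType K) (s : R) (y : nat -> X).
Hypothesis hs : 1 <= s.

Let s0 : 0 <= s. Proof. exact: le_trans hs. Qed.

Let Q N (f : X -> K^o) := \sum_(j < N) rnorm re (f (y j)) `^ s.

Let Q_ge0 N f : 0 <= Q N f.
Proof. by apply: sumr_ge0 => j _; exact: powR_ge0. Qed.

Let QD N f g : Q N (fun x => f x + g x) <= 2 `^ s * (Q N f + Q N g).
Proof.
rewrite /Q -big_split/= mulr_sumr; apply: ler_sum => j _.
apply: le_trans (powRD_le s0 (rnorm_ge0 hK _) (rnorm_ge0 hK _)).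
by rewrite ge0_ler_powR// ?nnegrE ?addr_ge0 ?(rnorm_ge0 hK)// (rnormD hK).
Qed.

Let QZ N (a : K) f : Q N (fun x => a *: f x) = rnorm re a `^ s * Q N f.
Proof.
rewrite /Q mulr_sumr; apply: eq_bigr => j _.
by rewrite (rnormZ hK) powRM// (rnorm_ge0 hK).
Qed.

Let ball := [set f : X -> K^o | linear f /\ functional_bound re f 1].

(** Finite for each [N], because only finitely many coordinates enter; uniform boundedness means
    that [S] is bounded. *)
Let S N := sup [set Q N f | f in ball].

Let ball0 : ball (fun=> 0).
Proof.
split=> [a u v|x]; first by rewrite scaler0 addr0.
by rewrite (rnorm0 hK) mul1r (rnorm_ge0 hK).
Qed.

Let has_supS N : has_sup [set Q N f | f in ball].
Proof.
split; first by exists (Q N (fun=> 0)); exists (fun=> 0).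
exists (\sum_(j < N) rnorm re (y j) `^ s) => _ [f [_ fb] <-].
apply: ler_sum => j _; rewrite ge0_ler_powR// ?nnegrE ?(rnorm_ge0 hK)//.
by rewrite (le_trans (fb _))// mul1r.
Qed.

Let Q_ball N f : ball f -> Q N f <= S N.
Proof. by move=> bf; apply: ub_le_sup; [case: (has_supS N) | exists f]. Qed.

Let S_ge0 N : 0 <= S N.
Proof. exact: le_trans (Q_ge0 N (fun=> 0)) (Q_ball N ball0). Qed.

Let Q_bound N (f : X -> K^o) D : linear f -> 0 <= D -> functional_bound re f D ->
  Q N f <= D `^ s * S N.
Proof.
apply: (sum_rnorm_homogeneous hK (lt_le_trans ltr01 hs)) => g lg bg.
exact: Q_ball.
Qed.

(* Sokal's elementary proof of the uniform boundedness principle: [G] is the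
   limit of functionals [F n], where [F n.+1] is either [F n] or [F n] plus a
   small multiple of a near-maximizer of some [Q N] on the unit ball, whichever
   has the larger [Q N]. The steps decrease so fast that [G] inherits a fixed
   proportion of this value; [64^-1] absorbs the constants coming from the
   quasi-triangle inequality [QD], as [s >= 1]. *)
Lemma gliding_hump : (forall W, exists N, W < S N) ->
  exists G : X -> K^o, [/\ linear G, functional_bound re G 2 &
    forall W, exists N, W < Q N G].
Proof.
move=> unb.
pose r n : R := 64^-1 ^+ n.
have r0 n : 0 < r n by rewrite exprn_gt0.
(* Even after scaling by r_n^s, the supremum over the ball exceeds [n]. *)
have /choice[Nn HN] n : exists N, n%:R / r n `^ s < S N by exact: unb.
have SN0 n : 0 < S (Nn n).
  by apply: le_lt_trans (HN n); rewrite divr_ge0// powR_ge0.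
have /choice[g Hg] n : exists g, ball g /\ S (Nn n) / 2 <= Q (Nn n) g.
  have e0 : 0 < S (Nn n) / 2 by rewrite divr_gt0.
  have [_ [g bg <-] Hg] := sup_adherent e0 (has_supS (Nn n)).
  exists g; split => //; apply: ltW; apply: le_lt_trans Hg.
  by rewrite -/(S _); lra.
have /choice[a ra] n : exists a, rnorm re a = r n := exists_rnorm hK (ltW (r0 n)).
pose add n (f : X -> K^o) x : K^o := f x + a n *: g n x.
pose fix F n : X -> K^o := if n is m.+1 then
  (if Q (Nn m) (F m) < Q (Nn m) (add m (F m)) then add m (F m) else F m)
  else fun=> 0.
have lF n : linear (F n).
  elim: n => [|n IH] b u v /=; first by rewrite scaler0 addr0.
  case: ifP => _; last exact: IH.
  rewrite /add IH; have [[lg _] _] := Hg n; rewrite lg.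
  by rewrite !scalerDr !scalerA [a n * b]mulrC addrACA.
have step n x : rnorm re (F n.+1 x - F n x) <= r n * rnorm re x.
  rewrite /=; case: ifP => _; last first.
    by rewrite subrr (rnorm0 hK) mulr_ge0 ?(rnorm_ge0 hK)// ltW.
  rewrite /add addrC addKr (rnormZ hK) ra ler_wpM2l//; first exact: ltW.
  by have [[_ gb] _] := Hg n; have := gb x; rewrite mul1r.
have tail n m x : (n <= m)%N ->
    rnorm re (F m x - F n x) <= 2 * r n * rnorm re x.
  move=> nm; apply: (@le_trans _ _ (2 * (r n - r m) * rnorm re x)); last first.
    by rewrite ler_wpM2r ?(rnorm_ge0 hK)// ler_wpM2l// gerBl ltW.
  elim: m nm => [|m IH].
    by rewrite leqn0 => /eqP ->; rewrite !subrr mulr0 mul0r (rnorm0 hK).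
  rewrite leq_eqVlt ltnS => /predU1P[->|/IH {}IH].
    by rewrite !subrr mulr0 mul0r (rnorm0 hK).
  rewrite -(subrKA (F m x)) (le_trans (rnormD hK _ _))//.
  apply: le_trans (lerD (step m x) IH) _.
  rewrite -mulrDl ler_wpM2r ?(rnorm_ge0 hK)//.
  by rewrite /r exprS -/(r m); have := r0 m; lra.
have r_cvg0 : r @ \oo --> 0.
  by apply: cvg_expr; rewrite ger0_norm// invf_lt1// ltr1n.
have limr0 (t C : R) : (forall n, t <= r n * C) -> t <= 0.
  move=> H; have : (r n * C) @[n --> \oo] --> 0 * C.
    by apply: cvgM => //; exact: cvg_cst.
  by rewrite mul0r => /cvgr_to_ge; apply; exact: nearW.
have /choice[G HG] x : exists l : K^o, forall n,
    rnorm re (l - F n x) <= 2 * r n * rnorm re x.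
  apply: (scalar_complete hK); last by move=> n m; exact: tail.
  have H : (2 * r n * rnorm re x) @[n --> \oo] --> 2 * 0 * rnorm re x.
    by apply: cvgM; [apply: cvgM => //|]; exact: cvg_cst.
  by rewrite mulr0 mul0r in H.
(* Each [F n] is linear, so the defect of linearity of [G] is at most a fixed multiple of [r n], for
   every [n]. *)
have lG : linear G.
  move=> b u v; apply/eqP; rewrite -subr_eq0; apply/negPn/negP.
  rewrite -(rnorm_gt0 hK) ltNge => /negP; apply.
  apply: (limr0 _ (2 * (rnorm re (b *: u + v) + rnorm re b * rnorm re u +
    rnorm re v))) => n.
  have -> : G (b *: u + v) - (b *: G u + G v) =
      (G (b *: u + v) - F n (b *: u + v)) - (b *: (G u - F n u)) - (G v - F n v).
    by rewrite lF scalerBr; ring.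
  rewrite (le_trans (rnormD hK _ _))// (rnormN re)//.
  have := rnormD hK (G (b *: u + v) - F n (b *: u + v)) (- (b *: (G u - F n u))).
  rewrite (rnormN re) (rnormZ hK).
  have := HG (b *: u + v) n; have := HG v n.
  have := ler_wpM2l (rnorm_ge0 hK b) (HG u n).
  set q := rnorm re b; set q' := rnorm re u.
  by move=> *; lra.
exists G; split => //.
  by move=> x; have := HG x 0%N; rewrite /= subr0 /r expr0 mulr1.
(* For [low]: the hump [a n *: g n] is the difference of the two candidates for [F n.+1], so the
   better one keeps a share of [q]. For [up]: all later steps together change the functional by at
   most 2 r_(n+1) = r_n/32 in norm. As [k] is at least 8, half of [q] survives. *)
have S_le n : r n `^ s * S (Nn n) <= 8 * 2 `^ s * 2 `^ s * Q (Nn n) G.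
  set q := r n `^ s * S (Nn n); set c := 2 `^ s; pose k : R := 8 `^ s.
  have c0 : 0 < c by exact: powR_gt0.
  have k8 : 8 <= k by rewrite le1r_powR//; lra.
  have low : q <= 4 * c * Q (Nn n) (F n.+1).
    have [_ Hgn] := Hg n.
    have : r n `^ s * Q (Nn n) (g n) <= 2 * c * Q (Nn n) (F n.+1).
      rewrite -(ra n) -QZ.
      have -> : Q (Nn n) (fun x => a n *: g n x) =
          Q (Nn n) (fun x => add n (F n) x + (-1) *: F n x).
        by apply: eq_bigr => j _; rewrite /add scaleN1r addrAC subrr add0r.
      apply: le_trans (QD _ _ _) _; rewrite QZ (rnormN re).
      rewrite (rnorm1 hK) powR1 mul1r -/c.
      have -> z : 2 * c * z = c * (z + z) by ring.
      rewrite ler_wpM2l ?(ltW c0)//.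
      rewrite [F n.+1]/=; case: ltP => [/ltW H|H]; first by rewrite lerD2l.
      by rewrite lerD2r.
    have := ler_wpM2l (powR_ge0 (r n) s) Hgn; rewrite -/q mulrA => H1 H2.
    by rewrite /q; lra.
  have up : Q (Nn n) (F n.+1) <= c * Q (Nn n) G + q / (c * k).
    have -> : Q (Nn n) (F n.+1) = Q (Nn n) (fun x => G x + (F n.+1 x - G x)).
      by apply: eq_bigr => j _; rewrite addrC subrK.
    apply: le_trans (QD _ _ _) _; rewrite mulrDr lerD2l.
    have -> : q / (c * k) = c * ((2 * r n.+1) `^ s * S (Nn n)).
      have -> : 2 * r n.+1 = r n / (2 * 2 * 8) by rewrite /r exprS; field.
      rewrite powRM ?invr_ge0// ?(ltW (r0 n))// powRV// !powRM// -/c -/k /q.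
      by field; rewrite !gt_eqF// powR_gt0.
    rewrite ler_wpM2l ?(ltW c0)//; apply: Q_bound => [b u v||x].
    - by rewrite lG lF scalerBr; ring.
    - by rewrite mulr_ge0// ltW.
    - by rewrite -(rnormN re) opprB; exact: HG.
  have ckq : c * (q / (c * k)) <= q / 8.
    have -> : c * (q / (c * k)) = q / k by field; rewrite !gt_eqF// powR_gt0.
    rewrite ler_wpM2l//; first by rewrite mulr_ge0 ?powR_ge0.
    by rewrite lef_pV2 ?posrE ?(lt_le_trans _ k8).
  have := ler_wpM2l (ltW c0) up; rewrite mulrDr mulrA => up'.
  have : q <= 4 * (c * c * Q (Nn n) G + q / 8) by lra.
  by move=> ?; lra.
move=> W.
pose C : R := 8 * 2 `^ s * 2 `^ s.
have C0 : 0 < C by rewrite !mulr_gt0// powR_gt0.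
pose n := (Num.truncn (W * C)).+1; exists (Nn n).
have := HN n; rewrite ltr_pdivrMr ?powR_gt0// => H.
rewrite -(ltr_pM2r C0); apply: (lt_trans (truncnS_gt _)).
by apply: (lt_le_trans H); rewrite [leRHS]mulrC [leLHS]mulrC; exact: S_le.
Qed.

(** If [S] were unbounded, the gliding hump would give a single bounded functional whose sum along
    [y] diverges, against weak summability. *)
Lemma weak_lp_bounded : weak_lp re s y -> exists2 W, 0 <= W &
  forall f : X -> K^o, linear f -> functional_bound re f 1 ->
    forall N, \sum_(j < N) rnorm re (f (y j)) `^ s <= W.
Proof.
move=> wy; have [[W HW]|unb] := pselect (exists W, forall N, S N <= W).
  exists W => [|f lf fD N]; first exact: le_trans (HW 0%N).
  by apply: le_trans (HW N); exact: Q_ball.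
have {}unb W : exists N, W < S N.
  apply: contrapT => nW; apply: unb; exists W => N.
  by rewrite leNgt; apply/negP => WN; apply: nW; exists N.
have [G [lG Gb Gunb]] := gliding_hump unb.
have [F FG] := dual_of_bounded hK lG Gb.
have s_neq0 : s != 0 by rewrite gt_eqF// (lt_le_trans _ hs).
have := wy F; rewrite /lp/= /lp_norm /lp_enorm Lnorm_counting; last first.
  by rewrite (lt_le_trans _ hs).
move=> /lty_poweRy; rewrite invr_eq0 => /(_ s_neq0).
have -> : (\sum_(0 <= k <oo) `|(rnorm re (F (y k)))%:E| `^ s =
    \sum_(0 <= k <oo) (rnorm re (G (y k)) `^ s)%:E)%E.
  by apply: eq_eseriesr => k _; rewrite FG/= ger0_norm// (rnorm_ge0 hK).
set e := limn _ => ey; have e0 : (0 <= e)%E.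
  by apply: nneseries_ge0 => k _ _; rewrite lee_fin powR_ge0.
have [N] := Gunb (fine e); rewrite ltNge => /negP[]; move: N.
have [+ _] := @nneseries_leP R (fun k => rnorm re (G (y k)) `^ s) (fine e)
  (fun k => powR_ge0 _ _).
apply.
by rewrite fineK// ge0_fin_numE.
Qed.

End uniform_boundedness.

(** * Sequences of functionals *)

Lemma poweR_leP (R : realType) (x : \bar R) (r C : R) :
  0 < r -> 0 <= C -> (0 <= x)%E ->
  (x `^ r^-1 <= C%:E)%E <-> (x <= (C `^ r)%:E)%E.
Proof.
move=> r0 C0 x0; case: x x0 => [x| |]; rewrite ?lee_fin// => x0; last first.
  by rewrite poweRyr ?invr_eq0 ?gt_eqF// !leye_eq.
rewrite ?poweR_EFin ?lee_fin; split => H.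
  rewrite -(powRr1 x0) -(mulVf (lt0r_neq0 r0)) powRrM.
  by rewrite ge0_ler_powR// ?nnegrE ?powR_ge0 ?ltW.
have := ge0_ler_powR (r := r^-1) _ _ _ H.
rewrite -powRrM mulfV ?gt_eqF// powRr1// => -> //.
- by rewrite invr_ge0 ltW.
- by rewrite nnegrE powR_ge0.
Qed.

Lemma lee_poweR (R : realType) (r : R) (x y : \bar R) :
  0 <= r -> (0 <= x)%E -> (x <= y)%E -> (x `^ r <= y `^ r)%E.
Proof.
move=> r0 x0 xy; apply: gt0_ler_poweR => //; rewrite in_itv/= leey andbT//.
exact: le_trans xy.
Qed.

Lemma lp_enormE (R : realType) (p : R) (a : nat -> R) :
  0 < p -> (forall j, 0 <= a j) ->
  (lp_enorm p (EFin \o a) = (\sum_(0 <= j <oo) (a j `^ p)%:E) `^ p^-1)%E.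
Proof.
move=> p0 a0; rewrite /lp_enorm Lnorm_counting//; congr (_ `^ _)%E.
by apply: eq_eseriesr => j _ /=; rewrite ger0_norm.
Qed.

Lemma lp_enorm_leP (R : realType) (p C : R) (a : nat -> R) :
  0 < p -> (forall j, 0 <= a j) -> 0 <= C ->
  (lp_enorm p (EFin \o a) <= C%:E)%E <->
  forall N, \sum_(j < N) a j `^ p <= C `^ p.
Proof.
move=> p0 a0 C0; rewrite lp_enormE//.
have s0 : (0 <= \sum_(0 <= j <oo) (a j `^ p)%:E)%E.
  by apply: nneseries_ge0 => j _ _; rewrite lee_fin powR_ge0.
have H := nneseries_leP (C `^ p) (fun j => powR_ge0 (a j) p).
by have [K L] := poweR_leP p0 C0 s0; split => [/K/H|/H/L].
Qed.

Lemma nneseries_ge_term (R : realType) (u : nat -> \bar R) n :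
  (forall k, 0 <= u k)%E -> (u n <= \sum_(0 <= k <oo) u k)%E.
Proof.
move=> u0; apply: le_trans (nneseries_lim_ge n.+1 _) => //.
by rewrite big_nat_recr//= leeDr// sume_ge0.
Qed.

Section dual_sequences.
Context {R : realType} {K : numFieldType} (re : K -> R).
Hypothesis hK : real_or_complex re.
Variables (X : normedModType K).

Lemma dual_norm_ge0 (f : dual X) : (0 <= dual_norm re f)%E.
Proof.
apply: ereal_sup_ubound; exists 0 => /=; first by rewrite normr0.
by rewrite linear0 (rnorm0 hK).
Qed.

Lemma dual_norm_fin (f : dual X) : dual_norm re f \is a fin_num.
Proof.
have [D D0 /(dual_normP hK f D0) fD] := dual_bounded hK f.
by rewrite ge0_fin_numE ?dual_norm_ge0// (le_lt_trans fD)// ltry.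
Qed.

(** The dual norms themselves serve as [D] in one direction; in the other any majorants do, so
    families can be estimated without computing their norms. *)
Lemma dual_lp_norm_leP (r C : R) (f : nat -> dual X) : 0 < r -> 0 <= C ->
  (dual_lp_norm re r f <= C%:E)%E <-> exists D : nat -> R,
    [/\ forall k, 0 <= D k, forall k, functional_bound re (f k) (D k) &
        forall N, \sum_(k < N) D k `^ r <= C `^ r].
Proof.
move=> r0 C0; pose d k := fine (dual_norm re (f k)).
have d0 k : 0 <= d k by rewrite fine_ge0 ?dual_norm_ge0.
have -> : dual_lp_norm re r f = lp_enorm r (EFin \o d).
  by congr (lp_enorm r _); apply/funext => k; rewrite /= fineK ?dual_norm_fin.
split=> [/(lp_enorm_leP r0 d0 C0) H|[D [D0 fD H]]].
  by exists d; split => // k; apply/(dual_normP hK) => //;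
    rewrite fineK ?dual_norm_fin.
apply/(lp_enorm_leP r0 d0 C0) => N; apply: le_trans (H N).
apply: ler_sum => k _; rewrite ge0_ler_powR ?nnegrE ?(ltW r0)//.
by rewrite -lee_fin fineK ?dual_norm_fin//; apply/(dual_normP hK).
Qed.

Lemma exists_dual_seq0 (r : R) : 0 < r -> exists f : nat -> dual X,
  (dual_lp_norm re r f <= 1)%E /\ forall k x, f k x = 0.
Proof.
move=> r0; have [F F0] := exists_dual0 hK X; exists (fun=> F); split => //.
apply/(dual_lp_norm_leP _ r0 ler01); exists (fun=> 0); split => //.
  by move=> _ x; rewrite F0 (rnorm0 hK) mul0r.
by move=> N; rewrite big1 ?powR1// => k _; rewrite powR0// gt_eqF.
Qed.

Lemma dual_lp_norm_sum_le (s C : R) (f : nat -> dual X) (x : X) :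
  0 < s -> 0 <= C -> (dual_lp_norm re s f <= C%:E)%E ->
  (\sum_(0 <= k <oo) (rnorm re (f k x) `^ s)%:E <= ((C * rnorm re x) `^ s)%:E)%E.
Proof.
move=> s0 C0 /(dual_lp_norm_leP _ s0 C0)[D [D0 fD DC]].
apply/nneseries_leP => [k|N]; first exact: powR_ge0.
rewrite powRM ?(rnorm_ge0 hK)//.
apply: le_trans (ler_wpM2r (powR_ge0 _ _) (DC N)).
rewrite mulr_suml; apply: ler_sum => k _; rewrite -powRM ?(rnorm_ge0 hK)//.
by rewrite ge0_ler_powR ?nnegrE ?mulr_ge0 ?(rnorm_ge0 hK) ?(fD k x) ?(ltW s0).
Qed.

End dual_sequences.

(** * Mixed sequences are anisotropic *)

Section mixed_anisotropic.
Context {R : realType} {K : numFieldType} (re : K -> R).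
Hypothesis hK : real_or_complex re.
Variables (X : normedModType K).

Lemma weak_lp_norm_ge0 (s : R) (y : nat -> X) : (0 <= weak_lp_norm re s y)%E.
Proof.
have [F F0] := exists_dual0 hK X.
apply: (@le_trans _ _ (lp_norm re s (fun j => F (y j)))); first exact: Lnorm_ge0.
apply: ereal_sup_ubound; exists F => //=; apply/(dual_normP hK) => // x.
by rewrite F0 (rnorm0 hK) mul1r (rnorm_ge0 hK).
Qed.

Lemma weak_lp_norm_fin (s : R) (y : nat -> X) : 1 <= s -> weak_lp re s y ->
  weak_lp_norm re s y \is a fin_num.
Proof.
move=> s1 wy; have s0 : 0 < s by rewrite (lt_le_trans _ s1).
have [W W0 HW] := weak_lp_bounded hK s1 wy.
rewrite ge0_fin_numE ?weak_lp_norm_ge0//.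
apply: (@le_lt_trans _ _ (W `^ s^-1)%:E); last by rewrite ltry.
apply: ge_ereal_sup => _ [f /= + <-] => /(dual_normP hK f ler01) fb.
apply/lp_enorm_leP; [by []|by move=> j; exact: rnorm_ge0|exact: powR_ge0|].
move=> N; rewrite -powRrM mulVf ?gt_eqF// powRr1//; apply: HW => //.
exact: linearP.
Qed.

Lemma weak_lp_sum_le (s : R) (y : nat -> X) (f : X -> K^o) D :
  1 <= s -> weak_lp re s y -> linear f -> 0 <= D -> functional_bound re f D ->
  (\sum_(0 <= j <oo) (rnorm re (f (y j)) `^ s)%:E <=
   ((D * fine (weak_lp_norm re s y)) `^ s)%:E)%E.
Proof.
move=> s1 wy lf D0 fD; have s0 : 0 < s by rewrite (lt_le_trans _ s1).
have W0 : 0 <= fine (weak_lp_norm re s y) by rewrite fine_ge0 ?weak_lp_norm_ge0.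
apply/nneseries_leP => [k|N]; first exact: powR_ge0.
rewrite powRM//; apply: (sum_rnorm_homogeneous hK s0) fD => // g lg gb.
have [G Gg] := dual_of_bounded hK lg gb.
have : (lp_norm re s (fun j => G (y j)) <= (fine (weak_lp_norm re s y))%:E)%E.
  rewrite fineK ?weak_lp_norm_fin//; apply: ereal_sup_ubound; exists G => //=.
  by apply/(dual_normP hK) => // x; rewrite Gg.
move/lp_enorm_leP => /(_ s0 (fun j => rnorm_ge0 hK _) W0 N).
by under eq_bigr do rewrite Gg.
Qed.

(** A general [C] gives membership for every family of finite norm, and the value 1 gives the
    inequality of norms. *)
Lemma anisotropic_sum_mixed_le (s q C : R) (x : nat -> X) ty (f : nat -> dual X) :
  1 <= q -> q < s -> mixed_representation re s q x ty -> 0 <= C ->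
  (dual_lp_norm re s f <= C%:E)%E ->
  (anisotropic_sum re s q f x <=
    ((fine (lp_norm re (mixed_exponent s q) ty.1) *
      fine (weak_lp_norm re s ty.2) * C) `^ q)%:E)%E.
Proof.
move: ty => [t y] q1 qs [/= lt wy xty] C0 fC.
set p := mixed_exponent s q; set T := fine _; set W := fine _.
have q0 : 0 < q by rewrite (lt_le_trans _ q1).
have s0 : 0 < s by rewrite (lt_trans q0).
have s1 : 1 <= s by rewrite (le_trans q1)// ltW.
have p0 : 0 < p by rewrite invr_gt0 subr_gt0 ltf_pV2// posrE.
have T0 : 0 <= T by rewrite fine_ge0 ?Lnorm_ge0.
have W0 : 0 <= W by rewrite fine_ge0 ?weak_lp_norm_ge0.
pose b j := fine (\sum_(0 <= k <oo) (rnorm re (f k (y j)) `^ s)%:E)%E.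
have sum_ge0 z : (0 <= \sum_(0 <= k <oo) (rnorm re (f k z) `^ s)%:E)%E.
  by apply: nneseries_ge0 => k _ _; rewrite lee_fin powR_ge0.
have bE j : (\sum_(0 <= k <oo) (rnorm re (f k (y j)) `^ s)%:E = (b j)%:E)%E.
  rewrite fineK// ge0_fin_numE//.
  by apply: le_lt_trans (dual_lp_norm_sum_le hK _ s0 C0 fC) _; rewrite ltry.
have b0 j : 0 <= b j by rewrite fine_ge0.
(* Once the sums are exchanged, each inner sum involves one functional [f k] and is controlled by
   the weak norm of [y]. *)
have sum_b : (\sum_(0 <= j <oo) (b j)%:E <= ((W * C) `^ s)%:E)%E.
  under eq_eseriesr do rewrite -bE.
  rewrite nneseries_interchange; last by move=> *; rewrite lee_fin powR_ge0.
  have [D [D0 fD DC]] := iffLR (dual_lp_norm_leP hK f s0 C0) fC.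
  apply: (@le_trans _ _ (\sum_(0 <= k <oo) ((D k * W) `^ s)%:E)%E).
    apply: lee_nneseries => [k _ _|k _].
      by apply: nneseries_ge0 => j _ _; rewrite lee_fin powR_ge0.
    by apply: weak_lp_sum_le => //; exact: linearP.
  apply/nneseries_leP => [k|N]; first exact: powR_ge0.
  under eq_bigr do rewrite powRM//.
  by rewrite -mulr_suml mulrC powRM// ler_wpM2l ?powR_ge0.
(* Since f_k(x_j) = t_j f_k(y_j), the scalar leaves the inner sum and the terms become [F j * G j];
   their sum is read as an L1 norm to fit Hoelder's inequality. *)
pose F j := rnorm re (t j) `^ q; pose G j := b j `^ (q / s).
have -> : anisotropic_sum re s q f x = 'N[counting]_(1%:E)[EFin \o (F \* G)%R]%E.
  rewrite Lnorm_counting// invr1 poweRe1; last first.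
    by apply: nneseries_ge0 => k _ _; rewrite poweR_ge0.
  apply: eq_eseriesr => j _ /=.
  rewrite ger0_norm ?mulr_ge0 ?powR_ge0// powRr1 ?mulr_ge0 ?powR_ge0//.
  have -> : (\sum_(0 <= k <oo) (rnorm re (f k (x j)) `^ s)%:E =
      (rnorm re (t j) `^ s * b j)%:E)%E.
    rewrite EFinM -bE -nneseriesZl; last by move=> k _; rewrite lee_fin powR_ge0.
    apply: eq_eseriesr => k _; rewrite xty linearZ/= (rnormZ hK).
    by rewrite powRM ?(rnorm_ge0 hK).
  rewrite poweR_EFin powRM ?powR_ge0// -powRrM [s * _]mulrC divfK ?gt_eqF//.
have mF (u : nat -> R) : measurable_fun setT u by [].
have pq0 : 0 < p / q by rewrite divr_gt0.
have sq0 : 0 < s / q by rewrite divr_gt0.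
have pqs : (p / q)^-1 + (s / q)^-1 = 1.
  rewrite !invf_div /p /mixed_exponent invrK.
  by field; rewrite !gt_eqF.
apply: le_trans (hoelder counting (mF F) (mF G) pq0 sq0 pqs) _.
have tE : lp_norm re p t = T%:E by rewrite fineK// ge0_fin_numE ?Lnorm_ge0.
have -> : 'N[counting]_((p / q)%:E)[EFin \o F]%E = (T `^ q)%:E.
  rewrite -poweR_EFin -tE [in RHS]/lp_norm [in RHS]lp_enormE//; last first.
    by move=> j; exact: rnorm_ge0.
  rewrite Lnorm_counting// -poweRrM invf_div [p^-1 * q]mulrC; congr (_ `^ _)%E.
  apply: eq_eseriesr => j _ /=.
  by rewrite /F ger0_norm ?powR_ge0// -powRrM [q * _]mulrC divfK// gt_eqF.
have : ('N[counting]_((s / q)%:E)[EFin \o G] <= ((W * C) `^ q)%:E)%E.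
  rewrite Lnorm_counting// invf_div.
  have -> : (W * C) `^ q = ((W * C) `^ s) `^ (q / s).
    by rewrite -powRrM [s * _]mulrC divfK// gt_eqF.
  rewrite -poweR_EFin; apply: lee_poweR.
  - by rewrite divr_ge0// ltW.
  - by apply: nneseries_ge0 => k _ _; rewrite poweR_ge0.
  apply: le_trans sum_b; apply: lee_nneseries => [k _ _|k _].
    by rewrite poweR_ge0.
  rewrite /= ger0_norm ?powR_ge0// -powRrM.
  have -> : q / s * (s / q) = 1 by field; rewrite !gt_eqF.
  by rewrite powRr1.
move=> H; rewrite -mulrA powRM ?mulr_ge0// (EFinM (T `^ q)).
by apply: lee_wpmul2l => //; rewrite lee_fin powR_ge0.
Qed.

End mixed_anisotropic.

(** * Finiteness of the anisotropic norm *)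

(** Both sides are the unordered sum over all pairs. This allows countably many families of
    functionals to be merged into one. *)
Lemma nneseries_pairing (R : realType) (e : nat -> nat * nat)
    (u : nat -> nat -> \bar R) :
  set_bij [set: nat] [set: nat * nat] e -> (forall n k, 0 <= u n k)%E ->
  (\sum_(0 <= m <oo) u (e m).1 (e m).2 =
   \sum_(0 <= n <oo) \sum_(0 <= k <oo) u n k)%E.
Proof.
move=> be u0; rewrite nneseries_esumT; last by move=> m; exact: u0.
rewrite -(reindex_esum setT setT e (fun z => u z.1 z.2))//.
rewrite nneseries_esumT; last by move=> n; exact: nneseries_ge0.
under [RHS]eq_esum do rewrite nneseries_esumT//.
rewrite esum_esum//; congr (esum _ _).
by apply/seteqP; split.
Qed.

Lemma sum_half_le (R : realType) N : \sum_(n < N) (2^-1 : R) ^+ n.+1 <= 1.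
Proof.
suff -> : \sum_(n < N) (2^-1 : R) ^+ n.+1 = 1 - 2^-1 ^+ N.
  by rewrite gerBl exprn_ge0.
elim: N => [|N IH]; first by rewrite big_ord0 expr0 subrr.
by rewrite big_ord_recr/= IH exprS; lra.
Qed.

Section anisotropic_bounded.
Context {R : realType} {K : numFieldType} (re : K -> R).
Hypothesis hK : real_or_complex re.
Variables (X : normedModType K).

(* If families [f n] of the unit ball had unbounded sums, the single family formed
   by all the [l n `^ s^-1 *: f n k], with [\sum_n l n <= 1], would lie in the
   unit ball and have an infinite sum. *)
Lemma anisotropic_bounded (s q : R) (x : nat -> X) : 0 < q -> 0 < s ->
  anisotropic re X s q s x -> exists M : R, forall f : nat -> dual X,
    (dual_lp_norm re s f <= 1)%E -> (anisotropic_sum re s q f x <= M%:E)%E.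
Proof.
move=> q0 s0 ax; apply: contrapT => unb.
pose l n : R := 2^-1 ^+ n.+1.
have l0 n : 0 < l n by rewrite exprn_gt0.
(* The sum still exceeds [n] after multiplication by l_n^(q/s), the cost of scaling the family by
   l_n^(1/s). *)
have /choice[f Hf] n : exists f : nat -> dual X, (dual_lp_norm re s f <= 1)%E /\
    ((n%:R / l n `^ (q / s))%:E < anisotropic_sum re s q f x)%E.
  apply: contrapT => nf; apply: unb; exists (n%:R / l n `^ (q / s)) => f f1.
  by rewrite leNgt; apply/negP => H; apply: nf; exists f.
have [e be] : exists e : nat -> nat * nat, set_bij [set: nat] [set: nat * nat] e.
  by apply/card_set_bijP; rewrite card_eq_sym card_nat2.
have /choice[a ra] n : exists a : K, rnorm re a = l n `^ s^-1.
  exact/(exists_rnorm hK)/powR_ge0.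
have ras n : rnorm re (a n) `^ s = l n.
  by rewrite ra -powRrM mulVf ?gt_eqF// powRr1// ltW.
have /choice[D HD] n := iffLR (dual_lp_norm_leP hK (f n) s0 ler01) (Hf n).1.
have /choice[g Hg] m : exists g : dual X,
    forall z, g z = a (e m).1 *: f (e m).1 (e m).2 z.
  have [b _ fb] := dual_bounded hK (f (e m).1 (e m).2).
  apply: (@dual_of_bounded _ _ _ hK _ _ (rnorm re (a (e m).1) * b)).
    by move=> c u v; rewrite linearP scalerDr !scalerA mulrC.
  by move=> z; rewrite (rnormZ hK) -mulrA ler_wpM2l// (rnorm_ge0 hK).
have g1 : (dual_lp_norm re s g <= 1)%E.
  apply/(dual_lp_norm_leP hK) => //.
  exists (fun m => rnorm re (a (e m).1) * D (e m).1 (e m).2); split.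
  - by move=> m; have [D0 _ _] := HD (e m).1; rewrite mulr_ge0 ?(rnorm_ge0 hK).
  - move=> m z; have [_ fD _] := HD (e m).1; rewrite Hg (rnormZ hK).
    by rewrite -mulrA ler_wpM2l ?(rnorm_ge0 hK)//; exact: fD.
  apply: (iffLR (@nneseries_leP _ (fun m => (rnorm re (a (e m).1) *
    D (e m).1 (e m).2) `^ s) _ (fun m => powR_ge0 _ s))).
  rewrite (nneseries_pairing (u := fun n k =>
      ((rnorm re (a n) * D n k) `^ s)%:E) be);
    last by move=> n k; rewrite lee_fin powR_ge0.
  apply: (@le_trans _ _ (\sum_(0 <= n <oo) (l n)%:E)%E); last first.
    by apply/nneseries_leP => [n|N]; [exact: ltW|rewrite powR1; exact: sum_half_le].
  apply: lee_nneseries => [n _ _|n _].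
    by apply: nneseries_ge0 => k _ _; rewrite lee_fin powR_ge0.
  have [D0 _ D1] := HD n; apply/nneseries_leP => [k|N]; first exact: powR_ge0.
  under eq_bigr do rewrite powRM ?(rnorm_ge0 hK)// ras.
  by rewrite -mulr_sumr ler_piMr ?(ltW (l0 n))// (le_trans (D1 N))// powR1.
have gfin : (anisotropic_sum re s q g x < +oo)%E.
  by apply: ax; apply: le_lt_trans g1 _; rewrite ltry.
have [n Hn] : exists n, (anisotropic_sum re s q g x < n%:R%:E)%E.
  have g0 : (0 <= anisotropic_sum re s q g x)%E.
    by apply: nneseries_ge0 => j _ _; exact: poweR_ge0.
  exists (Num.truncn (fine (anisotropic_sum re s q g x))).+1.
  by rewrite -[ltLHS]fineK ?lte_fin ?truncnS_gt// ge0_fin_numE.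
have sum_ge0 m z : (0 <= \sum_(0 <= k <oo) (rnorm re (f m k z) `^ s)%:E)%E.
  by apply: nneseries_ge0 => k _ _; rewrite lee_fin powR_ge0.
(* All rows of the merged family except the [n]-th are discarded; the remaining one contributes
   [l n] times the inner sum of [f n]. *)
have : ((l n `^ (q / s))%:E * anisotropic_sum re s q (f n) x <=
    anisotropic_sum re s q g x)%E.
  rewrite -nneseriesZl; last by move=> j _; exact: poweR_ge0.
  apply: lee_nneseries => [j _ _|j _].
    by rewrite mule_ge0 ?poweR_ge0// lee_fin powR_ge0.
  rewrite -poweR_EFin -poweRM ?lee_fin ?(ltW (l0 n))//.
  apply: lee_poweR; first by rewrite divr_ge0// ltW.
    by rewrite mule_ge0// lee_fin ltW.
  under [leRHS]eq_eseriesr => m _ do rewrite Hg (rnormZ hK).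
  rewrite (nneseries_pairing (u := fun m k =>
    ((rnorm re (a m) * rnorm re (f m k (x j))) `^ s)%:E) be); last first.
    by move=> m k; rewrite lee_fin powR_ge0.
  apply: le_trans (nneseries_ge_term n _); last first.
    by move=> m; apply: nneseries_ge0 => k _ _; rewrite lee_fin powR_ge0.
  rewrite -nneseriesZl; last by move=> k _; rewrite lee_fin powR_ge0.
  apply: lee_nneseries => [k _ _|k _].
    by rewrite mule_ge0 ?lee_fin ?powR_ge0// ltW.
  by rewrite powRM ?(rnorm_ge0 hK)// ras.
apply/negP; rewrite -ltNge; apply: lt_le_trans Hn _.
have [_ /ltW Hfn] := Hf n.
apply: le_trans (lee_wpmul2l _ Hfn); last by rewrite lee_fin powR_ge0.
by rewrite -EFinM mulrC divfK// gt_eqF// powR_gt0.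
Qed.

End anisotropic_bounded.

(** * Anisotropic sequences are mixed *)

(** A ratio in (0, 1] is at most its power th; this is summed over the shares of [a] and [d] in
    [a + d]. *)
Lemma powR_subadditive (R : realType) (th a d : R) : 0 < th -> th <= 1 ->
  0 <= a -> 0 < d -> (a + d) `^ th <= a `^ th + d `^ th.
Proof.
move=> th0 th1 a0 d0; have [a00|an0] := eqVneq a 0.
  by rewrite a00 add0r lerDr powR_ge0.
have agt0 : 0 < a by rewrite lt_def an0.
have ad0 : 0 < a + d by rewrite addr_gt0.
have sub u : 0 < u -> u <= a + d -> u / (a + d) * (a + d) `^ th <= u `^ th.
  move=> u0 uad; have -> : u `^ th = (u / (a + d)) `^ th * (a + d) `^ th.
    rewrite -powRM ?divfK ?gt_eqF//; last exact: ltW.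
    by rewrite divr_ge0// ltW.
  rewrite ler_wpM2r ?powR_ge0// ger1_powR//.
  by rewrite divr_gt0//= ler_pdivrMr// mul1r.
apply: le_trans (lerD (sub a _ _) (sub d _ _)) => //.
- by rewrite -mulrDl -mulrDl mulfV ?mul1r// gt_eqF.
- by rewrite lerDl ltW.
- by rewrite lerDr ltW.
Qed.

Section anisotropic_mixed.
Context {R : realType} {K : numFieldType} (re : K -> R).
Hypothesis hK : real_or_complex re.
Variables (X : normedModType K).

(** The maximization lemma applied to the inner sums of families in the unit ball, with single
    functionals as directions. The gap between [C0] and [C] pays for the shift. *)
Lemma anisotropic_sum_weights (s q C0 C : R) (x : nat -> X) :
  0 < q -> q < s -> 0 <= C0 -> C0 < C ->
  (forall f : nat -> dual X, (dual_lp_norm re s f <= 1)%E ->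
    (anisotropic_sum re s q f x <= (C0 `^ q)%:E)%E) ->
  exists c : nat -> R, [/\ forall j, 0 < c j,
    forall N, \sum_(j < N) c j `^ (q / s) <= C `^ q &
    forall g : dual X, (dual_norm re g <= 1)%E -> forall N,
      \sum_(j < N) rnorm re (g (x j)) `^ s * c j `^ (q / s - 1) <= C `^ q].
Proof.
move=> q0 qs C00 C0C Hx.
have s0 : 0 < s by exact: lt_trans qs.
pose th := q / s; have th0 : 0 < th by rewrite divr_gt0.
have th1 : th < 1 by rewrite ltr_pdivrMr// mul1r.
pose delta := C `^ q - C0 `^ q.
have delta0 : 0 < delta.
  by rewrite subr_gt0 gt0_ltr_powR// nnegrE// (le_trans C00)// ltW.
(* Chosen so that d_j^th is a geometric share of [delta]; by subadditivity the shift adds at most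
   [delta] to any sum. *)
pose d j : R := (delta * 2^-1 ^+ j.+1) `^ th^-1.
have d0 j : 0 < d j by rewrite powR_gt0// mulr_gt0// exprn_gt0.
have sum_d N : \sum_(j < N) d j `^ th <= delta.
  under eq_bigr => j _.
    rewrite -powRrM mulVf ?gt_eqF// powRr1; last first.
      by rewrite mulr_ge0 ?exprn_ge0// ltW.
    over.
  by rewrite -mulr_sumr ler_piMr ?sum_half_le// ltW.
pose S := [set A : nat -> R | exists f : nat -> dual X,
  (dual_lp_norm re s f <= 1)%E /\ forall j,
  (\sum_(0 <= k <oo) (rnorm re (f k (x j)) `^ s)%:E = (A j)%:E)%E].
pose T := [set b : nat -> R | exists g : dual X,
  (dual_norm re g <= 1)%E /\ forall j, b j = rnorm re (g (x j)) `^ s].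
have S_bound A : S A -> forall j, 0 <= A j <= rnorm re (x j) `^ s.
  move=> [f [f1 fA]] j; rewrite -!lee_fin -fA.
  have := dual_lp_norm_sum_le hK (x j) s0 ler01 f1; rewrite mul1r => ->.
  by rewrite andbT; apply: nneseries_ge0 => k _ _; rewrite lee_fin powR_ge0.
have T_ge0 b : T b -> forall j, 0 <= b j.
  by move=> [g [_ gb]] j; rewrite gb powR_ge0.
have S_neq0 : S !=set0.
  have [f [f1 f0]] := exists_dual_seq0 hK X s0; exists (fun=> 0), f; split => // j.
  by apply: eseries0 => k _ _; rewrite f0 (rnorm0 hK) powR0// gt_eqF.
(* The convex combination comes from the family with t^(1/s) g in front of the functionals (1 -
   t)^(1/s) f_k, whose s-th powers add up. *)
have S_conv A b t : S A -> T b -> 0 <= t <= 1 ->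
    S (fun j => (1 - t) * A j + t * b j).
  move=> [f [f1 fA]] [g [g1 gb]] /andP[t0 t1].
  have root_exists u : 0 <= u -> exists a : K, rnorm re a `^ s = u.
    move=> u0; have [a ra] := exists_rnorm hK (powR_ge0 u s^-1).
    by exists a; rewrite ra -powRrM mulVf ?gt_eqF// powRr1.
  have [a ta] := root_exists t t0.
  have [a' ta'] : exists a' : K, rnorm re a' `^ s = 1 - t.
    by apply: root_exists; rewrite subr_ge0.
  have [D [D0 fD D1]] := iffLR (dual_lp_norm_leP hK f s0 ler01) f1.
  have /(dual_normP hK g ler01) gb1 := g1.
  have scaled (u : K) (h : dual X) E : 0 <= E -> functional_bound re h E ->
      exists H : dual X, H =1 (fun z => u *: h z).
    move=> E0 hE; apply: (@dual_of_bounded _ _ _ hK _ _ (rnorm re u * E)).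
      by move=> c z w; rewrite linearP scalerDr !scalerA mulrC.
    by move=> z; rewrite (rnormZ hK) -mulrA ler_wpM2l// (rnorm_ge0 hK).
  have [G HG] := scaled a g 1 ler01 gb1.
  have /choice[F HF] k := scaled a' (f k) (D k) (D0 k) (fD k).
  exists (fun k => if k is k'.+1 then F k' else G); split => [|j].
    apply/(dual_lp_norm_leP hK) => //.
    exists (fun k => if k is k'.+1 then rnorm re a' * D k' else rnorm re a); split.
    - by case=> [|k]; rewrite ?mulr_ge0 ?(rnorm_ge0 hK).
    - case=> [|k] z; rewrite ?HG ?HF (rnormZ hK) -?mulrA.
        by rewrite ler_wpM2l ?(rnorm_ge0 hK)// (le_trans (gb1 z))// mul1r.
      by rewrite ler_wpM2l ?(rnorm_ge0 hK)//; exact: fD.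
    case=> [|N]; first by rewrite big_ord0 powR_ge0.
    rewrite big_ord_recl/= ta powR1.
    under eq_bigr do rewrite powRM ?(rnorm_ge0 hK)// ta'.
    rewrite -mulr_sumr -lerBrDl ler_piMr ?subr_ge0//.
    by rewrite (le_trans (D1 N))// powR1.
  rewrite nneseries_recl//; last by move=> k _; rewrite lee_fin powR_ge0.
  rewrite -nneseries_addn; last by move=> k; rewrite lee_fin powR_ge0.
  under eq_eseriesr => k _.
    rewrite addn1 HF (rnormZ hK) powRM ?(rnorm_ge0 hK)// ta' EFinM.
    over.
  rewrite nneseriesZl; last by move=> k _; rewrite lee_fin powR_ge0.
  by rewrite fA HG (rnormZ hK) powRM ?(rnorm_ge0 hK)// ta gb addeC.
have S_sum A N : S A -> \sum_(j < N) (A j + d j) `^ th <= C `^ q.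
  move=> SA; have [f [f1 fA]] := SA.
  apply: (@le_trans _ _ (\sum_(j < N) (A j `^ th + d j `^ th))).
    apply: ler_sum => j _; apply: powR_subadditive => //; first exact: ltW.
    by have /andP[] := S_bound _ SA j.
  rewrite big_split/=.
  have -> : C `^ q = C0 `^ q + delta by rewrite /delta; ring.
  apply: lerD; last exact: sum_d.
  apply: (iffLR (@nneseries_leP _ (fun j => A j `^ th) _ (fun j => powR_ge0 _ _))).
  apply: le_trans (Hx f f1); rewrite /anisotropic_sum.
  by under [leRHS]eq_eseriesr do rewrite fA.
have [c [c0 cM cT]] := concave_sum_maximizer th0 th1 S_neq0 S_bound T_ge0
  S_conv d0 S_sum.
exists c; split => // g g1 N.
by apply: (cT (fun j => rnorm re (g (x j)) `^ s)); exists g.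
Qed.

(** The two bounds on the weights [c] read ||t||_p^p <= C^q and ||y||_{w,s}^s <= C^q; as q/p + q/s =
    1, the product of the norms is at most [C]. *)
Lemma anisotropic_representation (s q C0 C : R) (x : nat -> X) :
  1 <= q -> q < s -> 0 <= C0 -> C0 < C ->
  (forall f : nat -> dual X, (dual_lp_norm re s f <= 1)%E ->
    (anisotropic_sum re s q f x <= (C0 `^ q)%:E)%E) ->
  exists ty, mixed_representation re s q x ty /\
    (lp_norm re (mixed_exponent s q) ty.1 * weak_lp_norm re s ty.2 <= C%:E)%E.
Proof.
move=> q1 qs C00 C0C Hx.
have q0 : 0 < q by exact: lt_le_trans q1.
have s0 : 0 < s by exact: lt_trans qs.
have C_ge0 : 0 <= C by rewrite (le_trans C00)// ltW.
have [c [c0 cM cT]] := anisotropic_sum_weights q0 qs C00 C0C Hx.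
set p := mixed_exponent s q.
have p0 : 0 < p by rewrite invr_gt0 subr_gt0 ltf_pV2// posrE.
pose u j := c j `^ (q / s / p).
have u0 j : 0 < u j by exact: powR_gt0.
have /choice[t tu] j : exists a : K, rnorm re a = u j.
  exact/(exists_rnorm hK)/ltW.
have t_neq0 j : t j != 0 by rewrite -(rnorm_gt0 hK) tu.
have rtV j : rnorm re (t j)^-1 = (u j)^-1.
  apply: (mulfI (lt0r_neq0 (u0 j))).
  by rewrite -{1}tu -(rnormM hK) !mulfV ?(rnorm1 hK)// gt_eqF.
(* The exponents agree because (q/s)(s/p) = 1 - q/s. *)
have weighted (g : dual X) j : rnorm re (g ((t j)^-1 *: x j)) `^ s =
    rnorm re (g (x j)) `^ s * c j `^ (q / s - 1).
  rewrite linearZ (rnormZ hK) rtV powRM ?(rnorm_ge0 hK) ?invr_ge0 ?(ltW (u0 j))//.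
  rewrite powRV ?(ltW (u0 j))// mulrC /u -powRrM -powRN; congr (_ * _ `^ _).
  by rewrite /p /mixed_exponent invrK; field; rewrite !gt_eqF.
pose y j := (t j)^-1 *: x j.
have lpt : (lp_norm re p t <= ((C `^ q) `^ p^-1)%:E)%E.
  apply/lp_enorm_leP => [//|j||N]; [exact: rnorm_ge0|exact: powR_ge0|].
  rewrite -[leRHS]powRrM mulVf ?gt_eqF// powRr1 ?powR_ge0//.
  under eq_bigr do rewrite tu /u -powRrM divfK ?gt_eqF//.
  exact: cM.
have wy1 (g : dual X) : (dual_norm re g <= 1)%E ->
    (lp_norm re s (fun j => g (y j)) <= ((C `^ q) `^ s^-1)%:E)%E.
  move=> g1; apply/lp_enorm_leP => [//|j||N]; [exact: rnorm_ge0|exact: powR_ge0|].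
  rewrite -[leRHS]powRrM mulVf ?gt_eqF// powRr1 ?powR_ge0//.
  under eq_bigr do rewrite weighted.
  exact: cT.
exists (t, y); split; first split => //=.
- by apply: le_lt_trans lpt _; rewrite ltry.
(* Membership in [weak_lp] concerns every functional, so the bound on the unit ball is extended by
   homogeneity. *)
- move=> g; have [D D0 gD] := dual_bounded hK g.
  apply: (@le_lt_trans _ _ (D * (C `^ q) `^ s^-1)%:E); last by rewrite ltry.
  apply/lp_enorm_leP => [//|j||N]; [exact: rnorm_ge0| |].
    by rewrite mulr_ge0 ?powR_ge0.
  rewrite powRM ?powR_ge0//.
  apply: (sum_rnorm_homogeneous hK s0) gD => //; last exact: linearP.
  move=> h lh hb; have [H Hh] := dual_of_bounded hK lh hb.
  have H1 : (dual_norm re H <= 1)%E.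
    by apply/(dual_normP hK) => // z; rewrite Hh.
  have /lp_enorm_leP := wy1 H H1.
  move=> /(_ s0 (fun j => rnorm_ge0 hK _) (powR_ge0 _ _) N).
  by under eq_bigr do rewrite Hh.
- by move=> j; rewrite /y scalerA mulfV// scale1r.
have -> : C%:E = (((C `^ q) `^ p^-1)%:E * ((C `^ q) `^ s^-1)%:E)%E.
  rewrite -EFinM -!powRrM -powRD; last first.
    by rewrite (gt_eqF (le_lt_trans C00 C0C)) implybT.
  rewrite /p /mixed_exponent invrK.
  have -> : q * (q^-1 - s^-1) + q / s = 1 by field; rewrite !gt_eqF.
  by rewrite powRr1.
apply: lee_pmul => //=; [exact: Lnorm_ge0|exact: weak_lp_norm_ge0|].
by apply: ge_ereal_sup => _ [g /= + <-]; exact: wy1.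
Qed.

End anisotropic_mixed.

(** * Equality of the two spaces and of their norms *)

Theorem theorem2p10 (R : realType) (K : numFieldType) (re : K -> R)
    (hK : real_or_complex re) (X : completeNormedModType K) (s q : R)
    (hq : 1 <= q) (hqs : q < s) :
  mixed re X s q = anisotropic re X s q s /\
  (forall x : nat -> X, mixed re X s q x ->
    mixed_norm re s q x = anisotropic_norm re s q s x).
Proof.
have q0 : 0 < q by exact: lt_le_trans hq.
have s0 : 0 < s by exact: lt_trans hqs.
have s1 : 1 <= s by rewrite (le_trans hq)// ltW.
have sum_ge0 (f : nat -> dual X) x : (0 <= anisotropic_sum re s q f x)%E.
  by apply: nneseries_ge0 => j _ _; exact: poweR_ge0.
have mixed_le x ty (f : nat -> dual X) C :
    mixed_representation re s q x ty -> 0 <= C -> (dual_lp_norm re s f <= C%:E)%E ->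
    (anisotropic_sum re s q f x <=
      ((fine (lp_norm re (mixed_exponent s q) ty.1) *
        fine (weak_lp_norm re s ty.2) * C) `^ q)%:E)%E.
  exact: anisotropic_sum_mixed_le.
(* Turns membership, which is only qualitative, into the uniform bound from which representations
   are built. *)
have norm_fin x : anisotropic re X s q s x -> exists C0, [/\ 0 <= C0,
    anisotropic_norm re s q s x = C0%:E &
    forall f : nat -> dual X, (dual_lp_norm re s f <= 1)%E ->
      (anisotropic_sum re s q f x <= (C0 `^ q)%:E)%E].
  move=> ax; have [M HM] := anisotropic_bounded hK q0 s0 ax.
  have [f0 [f01 _]] := exists_dual_seq0 hK X s0.
  have M0 : 0 <= M by rewrite -lee_fin (le_trans (sum_ge0 f0 x))// HM.
  have n0 : (0 <= anisotropic_norm re s q s x)%E.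
    apply: (@le_trans _ _ (anisotropic_sum re s q f0 x `^ q^-1)%E).
      exact: poweR_ge0.
    by apply: ereal_sup_ubound; exists f0.
  have nfin : anisotropic_norm re s q s x \is a fin_num.
    rewrite ge0_fin_numE// (@le_lt_trans _ _ (M `^ q^-1)%:E) ?ltry//.
    apply: ge_ereal_sup => _ [f /= f1 <-]; rewrite -poweR_EFin.
    by apply: lee_poweR (sum_ge0 f x) (HM f f1); rewrite invr_ge0 ltW.
  exists (fine (anisotropic_norm re s q s x)); split; first exact: fine_ge0.
    by rewrite fineK.
  move=> f f1; apply/(poweR_leP q0 (fine_ge0 n0) (sum_ge0 f x)).
  by rewrite fineK//; apply: ereal_sup_ubound; exists f.
have mixed_anisotropic x : mixed re X s q x -> anisotropic re X s q s x.
  move=> [ty xty] f flt.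
  have f0 : (0 <= dual_lp_norm re s f)%E by exact: Lnorm_ge0.
  have /mixed_le : mixed_representation re s q x ty by [].
  move=> /(_ f _ (fine_ge0 f0)); rewrite fineK ?ge0_fin_numE// => /(_ (lexx _)).
  by move=> /le_lt_trans; apply; rewrite ltry.
split.
  apply/seteqP; split => x; first exact: mixed_anisotropic.
  move=> /norm_fin[C0 [C00 _ HC0]].
  (* For membership any constant above [C0] will do. *)
  have C01 : C0 < C0 + 1 by rewrite ltrDl.
  by have [ty [xty _]] := anisotropic_representation hK hq hqs C00 C01 HC0;
    exists ty.
move=> x mx; have [C0 [C00 xC0 HC0]] := norm_fin x (mixed_anisotropic x mx).
apply/le_anti/andP; split.
  (* Representations are optimal only up to [e], which suffices for the infimum. *)
  rewrite xC0; apply/lee_addgt0Pr => e e0.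
  have C0e : C0 < C0 + e by rewrite ltrDl.
  have [ty [xty tyC]] := anisotropic_representation hK hq hqs C00 C0e HC0.
  rewrite -EFinD; apply: le_trans tyC; apply: ereal_inf_lbound.
  by exists ty.
apply: le_ereal_inf_tmp => _ [ty /= xty <-].
have [lt wy _] := xty.
have lfin : lp_norm re (mixed_exponent s q) ty.1 \is a fin_num.
  by rewrite ge0_fin_numE// Lnorm_ge0.
have wfin := weak_lp_norm_fin hK s1 wy.
apply: ge_ereal_sup => _ [f /= f1 <-].
rewrite -[leRHS]fineK ?fin_numM// fineM//.
have LW0 : 0 <= fine (lp_norm re (mixed_exponent s q) ty.1) *
    fine (weak_lp_norm re s ty.2).
  by rewrite mulr_ge0 ?fine_ge0 ?Lnorm_ge0 ?(weak_lp_norm_ge0 hK).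
apply/(poweR_leP q0 LW0 (sum_ge0 f x)).
by have := mixed_le _ _ _ _ xty ler01 f1; rewrite mulr1.
Qed.
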